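(* Let $A\in\mathscr R$ be a fixed set and let $F_1,F_2$ be distributions of random vectors in $[0,\infty)^d$. (a) Let $\mathcal B\in\{\mathcal C,\mathcal D,\mathcal L,\mathcal D\cap\mathcal L\}$. If $F_1\in\mathcal B_A$ and $F_2\in\mathcal B_A$, then the finite mixture $pF_1+(1-p)F_2$ belongs to $\mathcal B_A$ for every $p\in(0,1)$. (b) Let $\mathcal B\in\{\mathcal C,\mathcal L\}$. If $F_1\in\mathcal B_A$ and $F_2(xA)=o[F_1(xA)]$ as $x\to\infty$, then $pF_1+(1-p)F_2$ belongs to $\mathcal B_A$ for every $p\in(0,1)$.
   Context: Fix an integer $d\ge 1$. $\mathscr R$ is the family of nonempty sets $A\subsetneq\mathbb R^d$ that are open, increasing (if $\mathbf x\in A$ and $\mathbf a\in[0,\infty)^d$ then $\mathbf x+\mathbf a\in A$), have convex complement $A^c$, and satisfy $\mathbf 0\notin\overline A$ (closure). For a random vector $\mathbf X$ in $[0,\infty)^d$ with distribution $F$ write $F(xA):=\mathbf P[\mathbf X\in xA]$, put $Y_A:=\sup\{u>0:\mathbf X\in uA\}$ (with $\sup\emptyset=0$), and let $F_A$ be the distribution of $Y_A$; its tail is $\overline F_A(x)=\mathbf P[Y_A>x]=\mathbf P[\mathbf X\in xA]$ for $x>0$. For a distribution $V$ on $[0,\infty)$ write $\overline V=1-V$ and assume $\overline V(x)>0$ for all $x\ge0$. $V\in\mathcal C$ if $\lim_{b\uparrow1}\limsup_{x\to\infty}\overline V(bx)/\overline V(x)=1$. $V\in\mathcal D$ if $\limsup_{x\to\infty}\overline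 V(bx)/\overline V(x)<\infty$ for every (equivalently, some) $b\in(0,1)$. $V\in\mathcal L$ if $\lim_{x\to\infty}\overline V(x-y)/\overline V(x)=1$ for every (equivalently, some) $y>0$. $F\in\mathcal B_A$ means $F_A\in\mathcal B$. In particular, $pF_1+(1-p)F_2\in\mathcal B_A$ means that the one-dimensional distribution with tail $p\,\overline{F_A^{(1)}}(x)+(1-p)\,\overline{F_A^{(2)}}(x)$ is in $\mathcal B$, where $\overline{F_A^{(i)}}(x)=F_i(xA)$ for $x>0$. *)

(* Defs.v *)
From HB Require Import structures.
From mathcomp Require Import all_boot all_order all_algebra.
From mathcomp Require Import all_classical all_reals all_analysis.
From mathcomp Require Import measurable_realfun.
Import Order.TTheory GRing.Theory Num.Theory.
Import numFieldNormedType.Exports.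

Set Implicit Arguments.
Unset Strict Implicit.
Unset Printing Implicit Defensive.

Local Open Scope classical_set_scope.
Local Open Scope ring_scope.

(* lets the Landau notation [f =o_ +oo g] be used at +oo *)
Canonical pinfty_filter_on (R : realType) :=
  FilterType (pinfty_nbhs R) (@filter_filter _ _ proper_pinfty_nbhs).

(* R^d with its Borel sigma-algebra *)
Definition borel_rV (R : realType) (d : nat) :=
  g_sigma_algebraType (@open 'rV[R]_d).

Definition orthant (R : realType) (d : nat) : set 'rV[R]_d :=
  [set x | forall i, 0 <= x ord0 i].

Definition increasing_set (R : realType) (d : nat) (A : set 'rV[R]_d) :=
  forall x a, A x -> orthant a -> A (x + a).

Definition dilate (R : realType) (d : nat) (u : R) (A : set 'rV[R]_d) :
  set 'rV[R]_d := ( *:%R u) @` A.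

(* The family script-R; [rset_neq0] and [rset_neqT] say that the
   set is a nonempty proper subset of R^d *)
Record ruin_set (R : realType) (d : nat) := RuinSet {
  rset :> set 'rV[R]_d ;
  rset_neq0 : rset !=set0 ;
  rset_neqT : rset <> setT ;
  rset_open : open rset ;
  rset_increasing : increasing_set rset ;
  rset_convexC : convex_set (~` rset : set (convex_lmodType 'rV[R]_d)) ;
  rset_closure0 : ~ closure rset 0 }.

(* Y_A as a function of the value x of the random vector. The set is bounded
   above because 0 is not in the closure of A, and [sup set0 = 0] *)
Definition ruin_level (R : realType) (d : nat) (A : ruin_set R d)
    (x : borel_rV R d) : R :=
  sup [set u | 0 < u /\ dilate u A x].

Lemma dilateP (R : realType) (d : nat) (A : set 'rV[R]_d) (u : R)
  (x : 'rV[R]_d) : 0 < u -> dilate u A x <-> A (u^-1 *: x).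
Proof.
move=> u0; split=> [[a Aa <-]|Ax].
  by rewrite scalerA mulVf ?gt_eqF// scale1r.
by exists (u^-1 *: x) => //; rewrite scalerA mulfV ?gt_eqF// scale1r.
Qed.

Section ruin_level_measurable.
Variables (R : realType) (d : nat) (A : ruin_set R d).

Lemma open_dilate (u : R) : 0 < u -> open (dilate u A).
Proof.
move=> u0.
have -> : dilate u A = ( *:%R u^-1) @^-1` A.
  by apply/seteqP; split=> x /= /(dilateP _ _ u0).
apply: open_comp; last exact: rset_open.
by move=> x _; exact: scaler_continuous.
Qed.

Lemma ruin_level_ubound (x : 'rV[R]_d) :
  has_ubound [set u | 0 < u /\ dilate u A x].
Proof.
have [e e0 He] : exists2 e : R, 0 < e & forall y, (A : set _) y -> e <= `|y|.
  have := @rset_closure0 _ _ A; rewrite /closure /= => /existsNP[B].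
  move=> /not_implyP[/nbhs_ballP[e /= e0 eB] AB].
  exists e => // y Ay; rewrite leNgt; apply/negP => ye.
  by apply: AB; exists y; split => //; apply: eB;
    rewrite -ball_normE /= sub0r normrN.
exists (`|x| / e) => u [u0 [y Ay <-]].
by rewrite ler_pdivlMr// normrZ gtr0_norm// ler_pM2l// He.
Qed.

Lemma ruin_level_gt (r : R) (x : borel_rV R d) : 0 <= r ->
  r < ruin_level A x <-> exists2 u, r < u & dilate u A x.
Proof.
move=> r0; split=> [rx|[u ru uAx]]; last first.
  rewrite (lt_le_trans ru)//; apply: ub_le_sup; first exact: ruin_level_ubound.
  by split => //; exact: le_lt_trans ru.
have [S0|/set0P S0] := eqVneq [set u | 0 < u /\ dilate u A x] set0.
  by move: rx; rewrite /ruin_level S0 sup0 ltNge r0.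
have [|u [u0 uAx] ru] := sup_adherent (eps := ruin_level A x - r) _
  (conj S0 (ruin_level_ubound x)); first by rewrite subr_gt0.
by exists u => //; rewrite /ruin_level opprB addrCA subrr addr0 in ru.
Qed.

Lemma ruin_level_ge0 (x : borel_rV R d) : 0 <= ruin_level A x.
Proof.
rewrite /ruin_level.
have [->|/set0P[u uS]] := eqVneq [set u | 0 < u /\ dilate u A x] set0.
  by rewrite sup0.
rewrite (le_trans (ltW uS.1))//; apply: ub_le_sup => //.
exact: ruin_level_ubound.
Qed.

Lemma measurable_ruin_level : measurable_fun [set: borel_rV R d] (ruin_level A).
Proof.
apply: (measurability _ (RGenOInfty.measurableE R)) => _ [_ [r ->] <-].
rewrite setTI; have [r0|r0] := leP 0 r; last first.
  rewrite (_ : _ @^-1` _ = setT)//; apply/seteqP; split => // x _ /=.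
  by rewrite in_itv/= andbT (lt_le_trans r0)// ruin_level_ge0.
rewrite (_ : _ @^-1` _ = \bigcup_(u in [set u | r < u]) dilate u A).
  apply: sub_sigma_algebra; apply: bigcup_open => u /= ru.
  by apply: open_dilate; exact: le_lt_trans ru.
apply/seteqP; split => [x|x [u ru uAx]] /=; rewrite in_itv/= andbT.
  by move=> /(ruin_level_gt _ r0)[u ru uAx]; exists u.
by apply/(ruin_level_gt _ r0); exists u.
Qed.

HB.instance Definition _ :=
  isMeasurableFun.Build _ _ _ _ (ruin_level A) measurable_ruin_level.

(* F_A *)
Definition ruin_law (F : probability (borel_rV R d) R) :
  probability R R := distribution F (ruin_level A).

End ruin_level_measurable.

Section mixture.
Variables (d : measure_display) (T : measurableType d) (R : realType).
Variables (p : {i01 R}) (F1 F2 : probability T R).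

Definition mixture (B : set T) : \bar R :=
  ((p%:num)%:E * F1 B + (1 - p%:num)%:E * F2 B)%E.

Let q_ge0 : 0 <= 1 - p%:num. Proof. by rewrite subr_ge0. Qed.

Let mixtureE : mixture =
  measure_add (mscale (p%:num)%:nng F1) (mscale (NngNum q_ge0) F2).
Proof. by apply/funext => B; rewrite measure_addE. Qed.

Let mixture0 : mixture set0 = 0%E.
Proof. by rewrite mixtureE; exact: measure0. Qed.

Let mixture_ge0 B : (0 <= mixture B)%E.
Proof. by rewrite mixtureE; exact: measure_ge0. Qed.

Let mixture_sigma_additive : semi_sigma_additive mixture.
Proof. by rewrite mixtureE; exact: measure_semi_sigma_additive. Qed.

HB.instance Definition _ := isMeasure.Build _ _ _ mixture
  mixture0 mixture_ge0 mixture_sigma_additive.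

Let mixture_setT : mixture setT = 1%E.
Proof.
by rewrite /mixture !probability_setT !mule1 -EFinD addrCA subrr addr0.
Qed.

HB.instance Definition _ :=
  Measure_isProbability.Build _ _ _ mixture mixture_setT.

End mixture.

Section classes.
Variable R : realType.
Implicit Type V : probability R R.

Definition tail V (x : R) : R := fine (V `]x, +oo[%classic).

(* standing assumptions on the distributions V on [0, +oo[ that are classified *)
Definition classifiable V :=
  V `[0, +oo[%classic = 1%E /\ forall x : R, 0 <= x -> 0 < tail V x.

Definition limsup_tail_ratio V (b : R) : \bar R :=
  limf_esup (fun x : R => (tail V (b * x) / tail V x)%:E) +oo.

Definition class_C : set (probability R R) :=
  [set V | classifiable V /\ limsup_tail_ratio V b @[b --> 1^'-] --> 1%E].

Definition class_D : set (probability R R) :=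
  [set V | classifiable V /\
    forall b : R, 0 < b < 1 -> (limsup_tail_ratio V b < +oo)%E].

Definition class_L : set (probability R R) :=
  [set V | classifiable V /\
    forall y : R, 0 < y -> tail V (x - y) / tail V x @[x --> +oo] --> (1 : R)].

End classes.
Arguments class_C {R}.
Arguments class_D {R}.
Arguments class_L {R}.

Lemma ruin_set_shrink (R : realType) (d : nat) (A : ruin_set R d) (r u : R)
  (x : 'rV[R]_d) : 0 < r -> r <= u -> dilate u A x -> dilate r A x.
Proof.
move=> r0 ru /(dilateP _ _ (lt_le_trans r0 ru)) Aux; apply/(dilateP _ _ r0).
have u0 := lt_le_trans r0 ru.
apply: contrapT => nA.
have k01 : 0 <= r / u <= 1.
  by rewrite divr_ge0 ?(ltW r0) ?(ltW u0)//= ler_pdivrMr// mul1r.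
have [k0 k1] := andP k01.
have := @rset_convexC _ _ A (r^-1 *: x) 0 (Itv01 k0 k1).
rewrite !inE /conv /= scaler0 addr0 scalerA mulrAC mulfV ?gt_eqF// mul1r.
apply=> // A0; apply: (@rset_closure0 _ _ A); exact: subset_closure.
Qed.

Lemma ruin_law_tail (R : realType) (d : nat) (A : ruin_set R d)
    (F : probability (borel_rV R d) R) (x : R) : 0 < x ->
  ruin_law A F `]x, +oo[%classic = F (dilate x A).
Proof.
move=> x0; congr (F _); apply/seteqP; split => y /=; rewrite in_itv/= andbT.
  move=> /(ruin_level_gt _ _ (ltW x0))[u xu]; exact: ruin_set_shrink (ltW xu).
move=> xAy; apply/(ruin_level_gt _ _ (ltW x0)).
have cvy : (u^-1 *: (y : 'rV[R]_d)) @[u --> x] --> x^-1 *: (y : 'rV[R]_d).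
  by apply: cvgZr_tmp; apply: cvgV => //; rewrite gt_eqF.
have nA : nbhs (x^-1 *: (y : 'rV[R]_d)) A.
  by apply: open_nbhs_nbhs; split; [exact: rset_open|apply/dilateP].
near x^'+ => u.
exists u; first by near: u; exact: nbhs_right_gt.
have u0 : 0 < u by rewrite (lt_trans x0)//; near: u; exact: nbhs_right_gt.
apply/(dilateP _ _ u0); near: u.
exact: (cvg_at_right_filter cvy nA).
Unshelve. all: by end_near.
Qed.

(* Main.v *)
Require Import Defs.
From mathcomp Require Import all_boot all_order all_algebra.
From mathcomp Require Import all_classical all_reals all_analysis.
From mathcomp Require Import ring lra.
Import Order.TTheory GRing.Theory Num.Theory.
Import numFieldNormedType.Exports.
Local Open Scope classical_set_scope.
Local Open Scope ring_scope.

(** All three classes compare a tail with its own image under an argument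
    map [s]: [s x = b * x] for C and D, [s x = x - y] for L.  Tails are
    nonincreasing, so the ratio [tail V (s x) / tail V x] is eventually at
    least 1 and only its upper bounds carry information: every class amounts
    to inequalities [tail V (s x) <= c * tail V x] for large [x], with [c]
    arbitrarily close to 1 (C and L) or merely finite (D).  This is the
    content of [class_CP], [class_DP] and [class_LP].

    Such an inequality is linear in the tail, so it passes with the same [c]
    from two tails to any mixture of them ([near_shift_le_mix]); this gives
    the first part.  For the second part, the contribution of [F2] at [s x]
    is at most an arbitrarily small multiple of that of [F1] at [s x], because
    [s x] goes to infinity with [x]; the constant of the mixture is therefore
    as close as desired to the constant of [F1] ([near_shift_le_mix_littleo]).
    Both parts apply because the tail of the law of Y_A is linear in the
    distribution of the vector ([tail_ruin_law_mixture]). *)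

(** * Tail comparison along an argument map *)

Section near_shift_le.
Context {R : realType}.
Implicit Types f s : R -> R.

Definition near_shift_le f s c := \forall x \near +oo, f (s x) <= c * f x.

Lemma near_shift_le_mix f1 f2 s c p q : 0 <= p -> 0 <= q ->
  near_shift_le f1 s c -> near_shift_le f2 s c ->
  near_shift_le (fun x => p * f1 x + q * f2 x) s c.
Proof.
move=> p0 q0 H1 H2; near=> x.
have h1 : f1 (s x) <= c * f1 x by near: x.
have h2 : f2 (s x) <= c * f2 x by near: x.
by have := ler_wpM2l p0 h1; have := ler_wpM2l q0 h2; lra.
Unshelve. all: by end_near. Qed.

(** The weight of [f2] may be absorbed by any slack in the constant: with
    [f2 <= e * f1] at the point [s x], the mixture there is at most
    [(p + q * e) * c1 * f1 x]. *)
Lemma near_shift_le_mix_littleo f1 f2 s c1 c p q :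
  0 < p -> 0 <= q -> 0 < c1 < c -> s x @[x --> +oo] --> +oo ->
  (forall x, 0 <= f2 x) ->
  (forall e, 0 < e -> \forall x \near +oo, f2 x <= e * f1 x) ->
  near_shift_le f1 s c1 ->
  near_shift_le (fun x => p * f1 x + q * f2 x) s c.
Proof.
move=> p0 q0 /andP[c10 c1c] soo f20 f2o H1.
(* small enough for (p + q * e) * c1 <= p * c; the 1 added to q keeps the
   denominator positive when q = 0 *)
pose e := p * (c - c1) / (c1 * (q + 1)).
have e0 : 0 < e by rewrite divr_gt0 ?mulr_gt0 ?subr_gt0//; lra.
near=> x.
have h1 : f1 (s x) <= c1 * f1 x by near: x.
have h2 : f2 (s x) <= e * f1 (s x) by near: x; exact: soo _ (f2o _ e0).
have f1x : 0 <= c1 * f1 x.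
  apply: le_trans h1; rewrite -(pmulr_rge0 _ e0).
  exact: le_trans (f20 _) h2.
have f1x0 : 0 <= f1 x by rewrite -(pmulr_rge0 _ c10).
have qe : (p + q * e) * c1 <= p * c.
  have -> : (p + q * e) * c1 = p * c - p * (c - c1) / (q + 1).
    by rewrite /e; field; rewrite !gt_eqF//; lra.
  by rewrite gerBl divr_ge0 ?mulr_ge0 ?subr_ge0 ?addr_ge0// ltW.
have h3 : p * f1 (s x) + q * f2 (s x) <= (p + q * e) * f1 (s x).
  by have := ler_wpM2l q0 h2; lra.
apply: (le_trans h3).
have pqe : 0 <= p + q * e by rewrite addr_ge0 ?(ltW p0)// mulr_ge0 ?(ltW e0).
apply: (le_trans (ler_wpM2l pqe h1)).
rewrite mulrA; apply: (le_trans (ler_wpM2r f1x0 qe)).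
have c0 : 0 <= c by lra.
have : 0 <= c * (q * f2 x) by rewrite !mulr_ge0.
by lra.
Unshelve. all: by end_near. Qed.

End near_shift_le.

(** * The classes as tail comparisons *)

Section classes_near.
Context {R : realType}.
Implicit Type V : probability R R.

Lemma tail_ge0 V x : 0 <= tail V x.
Proof. exact: fine_ge0. Qed.

Lemma tail_nonincreasing V x y : x <= y -> tail V y <= tail V x.
Proof.
move=> xy; apply: fine_le; rewrite ?fin_num_measure//.
apply: le_measure; rewrite ?inE//.
by apply: subset_itvr; rewrite bnd_simp.
Qed.

Lemma limf_esup_lt (f : R -> R) (c : \bar R) :
  (limf_esup (EFin \o f) +oo%R < c)%E -> \forall x \near +oo, ((f x)%:E < c)%E.
Proof.
move=> /ereal_inf_lt[_ [U Uoo <-] Uc]; apply: filterS Uoo => x Ux.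
by apply: le_lt_trans Uc; apply: ereal_sup_ubound; exists x.
Qed.

Lemma limf_esup_le (f : R -> R) (c : \bar R) :
  (\forall x \near +oo, ((f x)%:E <= c)%E) ->
  (limf_esup (EFin \o f) +oo%R <= c)%E.
Proof.
move=> fc; apply: ge_ereal_inf.
exists (ereal_sup ((EFin \o f) @` [set x | ((f x)%:E <= c)%E])).
  by exists [set x | ((f x)%:E <= c)%E].
by apply: ge_ereal_sup => _ [x xc <-].
Qed.

Lemma limf_esup_ge (f : R -> R) (c : \bar R) :
  (\forall x \near +oo, (c <= (f x)%:E)%E) ->
  (c <= limf_esup (EFin \o f) +oo%R)%E.
Proof.
move=> cf; rewrite leNgt; apply/negP => /limf_esup_lt fc.
have [x] := filter_ex (filterI cf fc).
by move=> [/= /le_lt_trans h /h]; rewrite ltxx.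
Qed.

Lemma near_ratio_le V s c : classifiable V ->
  (\forall x \near +oo, tail V (s x) / tail V x <= c) <->
  near_shift_le (tail V) s c.
Proof.
move=> [_ V0]; split=> H; near=> x.
- rewrite -ler_pdivrMr; first by near: x.
  by apply: V0; near: x; exact: nbhs_pinfty_ge.
- rewrite ler_pdivrMr; first by near: x.
  by apply: V0; near: x; exact: nbhs_pinfty_ge.
Unshelve. all: by end_near. Qed.

Lemma tail_ratio_ge1 V x y : classifiable V -> 0 <= y -> x <= y ->
  1 <= tail V x / tail V y.
Proof.
by move=> [_ V0] y0 xy; rewrite ler_pdivlMr ?V0// mul1r tail_nonincreasing.
Qed.

Lemma limsup_tail_ratio_ge1 V b : classifiable V -> b <= 1 ->
  (1 <= limsup_tail_ratio V b)%E.
Proof.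
move=> cV b1; apply: limf_esup_ge; near=> x.
have x0 : 0 <= x by near: x; exact: nbhs_pinfty_ge.
by rewrite lee_fin; apply: tail_ratio_ge1 => //; rewrite ler_piMl.
Unshelve. all: by end_near. Qed.

(** The limsup of the ratio is at least 1 as soon as [b <= 1], so its
    convergence to 1 reduces to upper bounds. *)
Lemma class_CP V : class_C V <-> classifiable V /\
  forall c, 1 < c -> \forall b \near 1^'-, near_shift_le (tail V) ( *%R b) c.
Proof.
split=> -[cV H]; split=> //.
  move=> c c1.
  have : \forall b \near 1^'-, (limsup_tail_ratio V b < c%:E)%E.
    apply: (H [set u | (u < c%:E)%E]); apply: open_ereal_lt'.
    by rewrite lte_fin.
  apply: filterS => b /limf_esup_lt bc.
  by apply/near_ratio_le => //; apply: filterS bc => x; rewrite lte_fin => /ltW.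
have ge1 : \forall b \near 1^'-, (1 <= limsup_tail_ratio V b)%E.
  near=> b; apply: (limsup_tail_ratio_ge1 _ _ cV).
  by near: b; exact: nbhs_left_le.
have le c : 1 < c -> \forall b \near 1^'-, (limsup_tail_ratio V b <= c%:E)%E.
  move=> c1; near=> b; apply: limf_esup_le.
  by apply/near_ratio_le => //; near: b; exact: H.
have fin : \forall b \near 1^'-, limsup_tail_ratio V b \is a fin_num.
  have le2 := le 2 ltac:(lra).
  near=> b; rewrite fin_numElt.
  have b1 : (1 <= limsup_tail_ratio V b)%E by near: b.
  have b2 : (limsup_tail_ratio V b <= 2%:E)%E by near: b.
  by rewrite (lt_le_trans _ b1) ?ltNyr// (le_lt_trans b2) ?ltry.
apply/fine_cvgP; split=> //; apply/cvgrPdist_le => e e0.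
have lee := le (1 + e) ltac:(lra).
near=> b.
have fb : limsup_tail_ratio V b \is a fin_num by near: b.
have b1 : (1 <= limsup_tail_ratio V b)%E by near: b.
have be : (limsup_tail_ratio V b <= (1 + e)%:E)%E by near: b.
rewrite -(fineK fb) lee_fin in b1.
rewrite -(fineK fb) lee_fin in be.
by rewrite /= ler_norml; apply/andP; split; lra.
Unshelve. all: by end_near. Qed.

Lemma class_DP V : class_D V <-> classifiable V /\
  forall b, 0 < b < 1 -> exists c, near_shift_le (tail V) ( *%R b) c.
Proof.
split=> -[cV H]; split=> // b b01; have := H b b01.
  move=> /ereal_inf_lt[_ [U Uoo <-] Uy].
  exists (fine (ereal_sup [set (tail V (b * x) / tail V x)%:E | x in U])).
  apply/near_ratio_le => //; apply: filterS Uoo => x Ux.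
  have xU : ((tail V (b * x) / tail V x)%:E <=
    ereal_sup [set (tail V (b * x) / tail V x)%:E | x in U])%E.
    by apply: ereal_sup_ubound; exists x.
  rewrite -lee_fin fineK//.
  by rewrite fin_numElt Uy (lt_le_trans _ xU) ?ltNyr.
move=> [c /(near_ratio_le _ _ _ cV) bc].
by apply: (@le_lt_trans _ _ c%:E); rewrite ?ltry//; exact: limf_esup_le.
Qed.

(** As for C, the shifted ratio is at least 1 for every [x >= 0], so its
    convergence to 1 reduces to upper bounds. *)
Lemma class_LP V : class_L V <-> classifiable V /\
  forall y, 0 < y -> forall c, 1 < c ->
    near_shift_le (tail V) (fun x => x - y) c.
Proof.
split=> -[cV H]; split=> // y y0.
  move=> c c1; apply/near_ratio_le => //.
  exact: cvgr_le (H y y0) _ c1.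
apply/cvgrPdist_le => e e0.
have /(near_ratio_le _ _ _ cV) Hc := H y y0 (1 + e) ltac:(lra).
near=> x.
have ge : 1 <= tail V (x - y) / tail V x.
  by apply: (tail_ratio_ge1 _ _ _ cV); [near: x; exact: nbhs_pinfty_ge | lra].
have le : tail V (x - y) / tail V x <= 1 + e by near: x.
by rewrite ler_norml; apply/andP; split; lra.
Unshelve. all: by end_near. Qed.

End classes_near.

(** * Mixtures *)

(** The laws are related through their tails only, since the classes depend
    on nothing else once the support is in the half-line. *)
Section mixture_tail.
Context {R : realType}.
Variables (V1 V2 W : probability R R) (p q : R).
Hypotheses (p0 : 0 < p) (q0 : 0 < q) (suppW : W `[0, +oo[%classic = 1%E).
Hypothesis tailW : tail W = (fun x => p * tail V1 x + q * tail V2 x).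

(** Positivity of a single component tail is enough: a negligible second
    component may well have bounded support. *)
Lemma classifiable_mix : classifiable V1 -> classifiable W.
Proof.
move=> [_ V10]; split=> // x x0.
by rewrite tailW ltr_wpDr ?mulr_ge0 ?tail_ge0 ?(ltW q0)// mulr_gt0 ?V10.
Qed.

Let near_tail_mix s c : near_shift_le (tail V1) s c ->
  near_shift_le (tail V2) s c -> near_shift_le (tail W) s c.
Proof. by rewrite tailW; apply: near_shift_le_mix; exact: ltW. Qed.

Lemma class_C_mix : class_C V1 -> class_C V2 -> class_C W.
Proof.
move=> /class_CP[cV1 H1] /class_CP[_ H2]; apply/class_CP; split.
  exact: classifiable_mix.
move=> c c1; apply: filterS (filterI (H1 c c1) (H2 c c1)) => b [].
exact: near_tail_mix.
Qed.

Lemma class_D_mix : class_D V1 -> class_D V2 -> class_D W.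
Proof.
move=> /class_DP[cV1 H1] /class_DP[_ H2]; apply/class_DP; split.
  exact: classifiable_mix.
move=> b b01; have [c1 Hc1] := H1 b b01; have [c2 Hc2] := H2 b b01.
exists (Num.max c1 c2); apply: near_tail_mix.
- apply: filterS Hc1 => x /le_trans; apply.
  by rewrite ler_wpM2r ?tail_ge0// le_max lexx.
- apply: filterS Hc2 => x /le_trans; apply.
  by rewrite ler_wpM2r ?tail_ge0// le_max lexx orbT.
Qed.

Lemma class_L_mix : class_L V1 -> class_L V2 -> class_L W.
Proof.
move=> /class_LP[cV1 H1] /class_LP[_ H2]; apply/class_LP; split.
  exact: classifiable_mix.
by move=> y y0 c c1; apply: near_tail_mix; [exact: H1|exact: H2].
Qed.

Hypothesis V2o : forall e, 0 < e ->
  \forall x \near +oo, tail V2 x <= e * tail V1 x.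

(* the first component is controlled with the midpoint of 1 and c, which
   leaves room for the second one *)
Let near_tail_mix_littleo s c : 1 < c -> s x @[x --> +oo] --> +oo ->
  near_shift_le (tail V1) s ((1 + c) / 2) -> near_shift_le (tail W) s c.
Proof.
move=> c1 soo H1; rewrite tailW.
apply: (near_shift_le_mix_littleo _ _ _ ((1 + c) / 2)) => //.
- exact: ltW.
- by lra.
- by move=> x; exact: tail_ge0.
Qed.

Lemma class_C_mix_littleo : class_C V1 -> class_C W.
Proof.
move=> /class_CP[cV1 H1]; apply/class_CP; split; first exact: classifiable_mix.
move=> c c1; near=> b; apply: near_tail_mix_littleo => //.
- by apply: gt0_cvgMry => //; near: b; exact: nbhs_left_gt.
- by near: b; apply: H1; lra.
Unshelve. all: by end_near. Qed.

Lemma class_L_mix_littleo : class_L V1 -> class_L W.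
Proof.
move=> /class_LP[cV1 H1]; apply/class_LP; split; first exact: classifiable_mix.
move=> y y0 c c1; apply: near_tail_mix_littleo => //; first exact: cvg_addrr.
by apply: H1 => //; lra.
Qed.

End mixture_tail.

Section ruin_law_mixture.
Context {R : realType} {d : nat}.
Variables (A : ruin_set R d).
Implicit Types F : probability (borel_rV R d) R.

Lemma ruin_law_support F : ruin_law A F `[0, +oo[%classic = 1%E.
Proof.
rewrite -(@probability_setT _ _ _ F); congr (F _).
by apply/seteqP; split=> // x _ /=; rewrite in_itv/= andbT ruin_level_ge0.
Qed.

Lemma tail_ruin_law_mixture (p : {i01 R}) F1 F2 :
  tail (ruin_law A (mixture p F1 F2)) =
  fun x => p%:num * tail (ruin_law A F1) x
           + (1 - p%:num) * tail (ruin_law A F2) x.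
Proof.
apply/funext => x; rewrite /tail.
have fin F : ruin_law A F `]x, +oo[%classic \is a fin_num.
  exact: fin_num_measure.
have -> : ruin_law A (mixture p F1 F2) `]x, +oo[%classic =
    (p%:num%:E * ruin_law A F1 `]x, +oo[%classic
     + (1 - p%:num)%:E * ruin_law A F2 `]x, +oo[%classic)%E by [].
by rewrite -(fineK (fin F1)) -(fineK (fin F2)) -!EFinM -EFinD.
Qed.

(** The identity of [F (dilate x A)] with the tail of the law of Y_A needs
    [0 < x], hence the passage through an eventual comparison. *)
Lemma tail_littleo F1 F2 :
  (fun x : R^o => fine (F2 (dilate x A)) : R^o) =o_ +oo
    (fun x : R^o => fine (F1 (dilate x A)) : R^o) ->
  forall e, 0 < e -> \forall x \near +oo,
    tail (ruin_law A F2) x <= e * tail (ruin_law A F1) x.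
Proof.
move=> /eqoP H e e0; near=> x.
have x0 : 0 < x by near: x; exact: nbhs_pinfty_gt.
have : `|fine (F2 (dilate x A))| <= e * `|fine (F1 (dilate x A))|.
  by near: x; exact: H.
by rewrite !ger0_norm ?fine_ge0// /tail !ruin_law_tail.
Unshelve. all: by end_near. Qed.

End ruin_law_mixture.

Theorem proposition3p1 (R : realType) (d : nat) (d_ge1 : (1 <= d)%N)
    (A : ruin_set R d) (F1 F2 : probability (borel_rV R d) R)
    (F1_orthant : F1 (orthant (R := R) (d := d)) = 1%E)
    (F2_orthant : F2 (orthant (R := R) (d := d)) = 1%E) :
  (forall B : set (probability R R),
     [set class_C; class_D; class_L; class_D `&` class_L] B ->
     B (ruin_law A F1) -> B (ruin_law A F2) ->
     forall p : {i01 R}, 0 < p%:num < 1 ->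
       B (ruin_law A (mixture p F1 F2))) /\
  (forall B : set (probability R R),
     [set class_C; class_L] B ->
     B (ruin_law A F1) ->
     (fun x : R^o => fine (F2 (dilate x A)) : R^o) =o_ +oo
       (fun x : R^o => fine (F1 (dilate x A)) : R^o) ->
     forall p : {i01 R}, 0 < p%:num < 1 ->
       B (ruin_law A (mixture p F1 F2))).
Proof.
have suppW p := ruin_law_support A (mixture p F1 F2).
have tailW p := tail_ruin_law_mixture A p F1 F2.
split=> B.
  move=> HB B1 B2 p /andP[p0]; rewrite -subr_gt0 => q0.
  case: HB B1 B2 => [[[|]|]|] -> B1 B2.
  - exact: (class_C_mix _ _ _ _ _ p0 q0 (suppW p) (tailW p)).
  - exact: (class_D_mix _ _ _ _ _ p0 q0 (suppW p) (tailW p)).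
  - exact: (class_L_mix _ _ _ _ _ p0 q0 (suppW p) (tailW p)).
  - case: B1 B2 => [D1 L1] [D2 L2]; split.
      exact: (class_D_mix _ _ _ _ _ p0 q0 (suppW p) (tailW p) D1 D2).
    exact: (class_L_mix _ _ _ _ _ p0 q0 (suppW p) (tailW p) L1 L2).
move=> HB B1 /tail_littleo F2o p /andP[p0]; rewrite -subr_gt0 => q0.
case: HB B1 => -> B1.
- exact: (class_C_mix_littleo _ _ _ _ _ p0 q0 (suppW p) (tailW p) F2o).
- exact: (class_L_mix_littleo _ _ _ _ _ p0 q0 (suppW p) (tailW p) F2o).
Qed.
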